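(* The subring $R\subset\mathbb{C}[\mathfrak{X}]$ is preserved by $\mathfrak{D}$, and $\mathfrak{D}$ restricted to $R$ (that is, the group of automorphisms of $R$ induced by $\mathfrak{D}$) is isomorphic as a group to the dihedral group $D_4$ of order $8$. Moreover, the algebraically independent generators are characterized, among the nine generators $t_{(\pm1)},t_{(\pm2)},t_{(\pm3)},t_{(\pm4)},t_{(5)}$ of $\mathbb{C}[\mathfrak{X}]$, as those on which $\mathfrak{D}$ acts as a permutation group: $\mathfrak{D}$ permutes the set $\{t_{(\pm i)}\mid 1\le i\le4\}$, but does not act by permutations on this set together with $t_{(5)}$.
   Context: Let $G=\mathrm{SL}(3,\mathbb{C})$ and let $\mathbb{C}[\mathfrak{X}]=\mathbb{C}[G\times G]^G$ be the ring of regular functions on $G\times G$ invariant under simultaneous conjugation. Write $\mathbf{x}_1,\mathbf{x}_2$ for the two coordinate (generic) matrices. For a word $\mathtt{w}$ in the free group $\mathtt{F}_2=\langle\mathtt{x}_1,\mathtt{x}_2\rangle$, $\mathbf{w}$ denotes the matrix obtained by substituting $\mathtt{x}_i\mapsto\mathbf{x}_i$. In $\mathbb{C}[\mathfrak{X}]$ put $t_{(1)}=\mathrm{tr}(\mathbf{x}_1)$, $t_{(-1)}=\mathrm{tr}(\mathbf{x}_1^{-1})$, $t_{(2)}=\mathrm{tr}(\mathbf{x}_2)$, $t_{(-2)}=\mathrm{tr}(\mathbf{x}_2^{-1})$, $t_{(3)}=\mathrm{tr}(\mathbf{x}_1\mathbf{x}_2)$, $t_{(-3)}=\mathrm{tr}(\mathbf{x}_1^{-1}\mathbf{x}_2^{-1})$,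 $t_{(4)}=\mathrm{tr}(\mathbf{x}_1\mathbf{x}_2^{-1})$, $t_{(-4)}=\mathrm{tr}(\mathbf{x}_1^{-1}\mathbf{x}_2)$, $t_{(5)}=\mathrm{tr}(\mathbf{x}_1\mathbf{x}_2\mathbf{x}_1^{-1}\mathbf{x}_2^{-1})$. These nine elements generate $\mathbb{C}[\mathfrak{X}]$, and the eight elements $t_{(\pm i)}$, $1\le i\le4$, are algebraically independent. $R$ denotes the subring $\mathbb{C}[t_{(\pm i)}\mid1\le i\le4]$. The group $\mathrm{Out}(\mathtt{F}_2)$ acts on $\mathbb{C}[\mathfrak{X}]$ by algebra automorphisms via $\alpha\cdot\mathrm{tr}(\mathbf{w})=\mathrm{tr}(\alpha(\mathbf{w}))$. $\mathfrak{D}\subset\mathrm{Out}(\mathtt{F}_2)$ is the subgroup generated by (the classes of) $\tau:\mathtt{x}_1\mapsto\mathtt{x}_2,\ \mathtt{x}_2\mapsto\mathtt{x}_1$ and $\iota:\mathtt{x}_1\mapsto\mathtt{x}_1^{-1},\ \mathtt{x}_2\mapsto\mathtt{x}_2$. *)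

(* Defs.v *)
From HB Require Import structures.
From mathcomp Require Import all_boot all_order all_algebra all_fingroup all_solvable.
From mathcomp Require Import generic_quotient.
From mathcomp Require Import boolp classical_sets functions.
From mathcomp Require Import reals.
From mathcomp Require Import complex.

Set Implicit Arguments.
Unset Strict Implicit.
Unset Printing Implicit Defensive.

Import GRing.Theory.

Local Open Scope group_scope.
Local Open Scope classical_set_scope.

Section FreeGroup.
Variable I : choiceType.

(* [(i, false)] stands for the generator [i], [(i, true)] for its inverse. *)
Local Notation letter := (I * bool)%type.

Definition linv (a : letter) : letter := (a.1, ~~ a.2).

Definition reduced (w : seq letter) := sorted (fun a b => b != linv a) w.

(* The reduced form of [a :: w], for [w] reduced. *)
Definition lcons (a : letter) (w : seq letter) : seq letter :=
  if w is b :: w' then (if b == linv a then w' else a :: w) else [:: a].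

Lemma linvK : involutive linv.
Proof. by case=> i b; rewrite /linv /= negbK. Qed.

Lemma lcons_reduced a w : reduced w -> reduced (lcons a w).
Proof.
case: w => [//|b w] /=; case: ifP => [_ /path_sorted //|/negbT ab] /= bw.
by rewrite ab.
Qed.

Lemma lconsK a w : reduced w -> lcons a (lcons (linv a) w) = w.
Proof.
case: w => [|b w] /=; first by rewrite eqxx.
rewrite linvK; case: eqP => [->|_] /= bw; last by rewrite eqxx.
by case: w bw => [//|c w] /= /andP[/negPf ->].
Qed.

Lemma lconsVK a w : reduced w -> lcons (linv a) (lcons a w) = w.
Proof. by move=> rw; rewrite -{2}(linvK a) lconsK. Qed.

Definition lcat (u v : seq letter) := foldr lcons v u.

Lemma lcat_reduced u v : reduced v -> reduced (lcat u v).
Proof. by move=> rv; elim: u => //= a u; apply: lcons_reduced. Qed.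

Lemma lcat_lcons a u v : reduced v -> lcat (lcons a u) v = lcons a (lcat u v).
Proof.
move=> rv; case: u => [//|b u] /=; case: eqP => [->|//].
by rewrite lconsK// lcat_reduced.
Qed.

Lemma lcatA u v w : reduced w -> lcat u (lcat v w) = lcat (lcat u v) w.
Proof. by move=> rw; elim: u => //= a u ->; rewrite lcat_lcons. Qed.

Lemma lcats0 u : reduced u -> lcat u [::] = u.
Proof.
elim: u => //= a u IH au; rewrite IH; last exact: path_sorted au.
by case: u au {IH} => //= b u /andP[/negPf ->].
Qed.

Definition lrev (u : seq letter) := rev (map linv u).

Lemma lrevK : involutive lrev.
Proof.
move=> u; rewrite /lrev map_rev revK -map_comp -[RHS]map_id.
by apply: eq_map => a /=; rewrite linvK.
Qed.

Lemma lcatV u : reduced u -> lcat (lrev u) u = [::].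
Proof.
rewrite /lrev; elim: u => //= a u IH au.
rewrite rev_cons /lcat foldr_rcons /= linvK eqxx.
exact/IH/(path_sorted au).
Qed.

Lemma lrev_reduced u : reduced u -> reduced (lrev u).
Proof.
rewrite /reduced /lrev rev_sorted sorted_map; apply: sub_sorted => a b ab.
change (is_true (linv a != linv (linv b))); rewrite linvK.
by apply: contraNneq ab => <-.
Qed.

Record freeGroup := FreeGroup { fgval : seq letter; _ : reduced fgval }.
HB.instance Definition _ := [isSub for fgval].
HB.instance Definition _ := [Choice of freeGroup by <:].

Implicit Types u v w : freeGroup.

Definition fg_one : freeGroup := @FreeGroup [::] isT.
Definition fg_mul u v : freeGroup :=
  FreeGroup (lcat_reduced (val u) (valP v)).
Definition fg_inv u : freeGroup := FreeGroup (lrev_reduced (valP u)).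

Fact fg_mulA : associative fg_mul.
Proof. by move=> u v w; apply/val_inj/lcatA/valP. Qed.
Fact fg_mul1 : left_id fg_one fg_mul.
Proof. by move=> u; apply/val_inj. Qed.
Fact fg_mulr1 : right_id fg_one fg_mul.
Proof. by move=> u; apply/val_inj/lcats0/valP. Qed.
Fact fg_mulV : left_inverse fg_one fg_inv fg_mul.
Proof. by move=> u; apply/val_inj/lcatV/valP. Qed.
Fact fg_mulrV : right_inverse fg_one fg_inv fg_mul.
Proof.
move=> u; apply/val_inj; rewrite /= -{1}(lrevK (val u)).
exact/lcatV/lrev_reduced/valP.
Qed.
HB.instance Definition _ :=
  isGroup.Build freeGroup fg_mulA fg_mul1 fg_mulr1 fg_mulV fg_mulrV.

Definition fg_gen (i : I) : freeGroup := @FreeGroup [:: (i, false)] isT.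

Section Lift.
Variables (G : groupType) (g : I -> G).

Definition letter_val (a : letter) : G := if a.2 then (g a.1)^-1 else g a.1.

Definition fg_lift (w : freeGroup) : G := \prod_(a <- val w) letter_val a.

Lemma letter_valV a : letter_val (linv a) = (letter_val a)^-1.
Proof. by case: a => i [] //=; rewrite /letter_val /= invgK. Qed.

Lemma prod_lcons a s :
  \prod_(b <- lcons a s) letter_val b =
  letter_val a * \prod_(b <- s) letter_val b.
Proof.
case: s => [|b s] /=; first by rewrite !big_cons.
case: eqP => [->|_]; rewrite !big_cons// letter_valV mulgA mulgV.
by rewrite mul1g.
Qed.

Lemma fg_liftM : {morph fg_lift : u v / u * v}.
Proof.
move=> u v; rewrite /fg_lift; change (val (u * v)) with (lcat (val u) (val v)).
elim: (val u) => [|a s IH] /=; first by rewrite big_nil mul1g.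
by rewrite prod_lcons IH big_cons mulgA.
Qed.

Lemma fg_lift_gen i : fg_lift (fg_gen i) = g i.
Proof. by rewrite /fg_lift big_seq1. Qed.

End Lift.

Lemma morphg1 (G H : groupType) (f : G -> H) :
  {morph f : x y / x * y} -> f 1 = 1.
Proof. by move=> fM; apply: (mulgI (f 1)); rewrite -fM !mulg1. Qed.

Lemma morphgV (G H : groupType) (f : G -> H) :
  {morph f : x y / x * y} -> {morph f : x / x^-1}.
Proof.
by move=> fM x; apply: (mulgI (f x)); rewrite -fM !mulgV morphg1.
Qed.

Lemma fg_lift_unique (G : groupType) (f : freeGroup -> G) :
  {morph f : u v / u * v} -> f =1 fg_lift (f \o fg_gen).
Proof.
move=> fM [s rs]; elim: s rs => [|a s IH] rs.
  rewrite /fg_lift big_nil -(morphg1 fM); congr (f _); exact: val_inj.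
have rs' : reduced s by apply: path_sorted rs.
have ga : letter_val (f \o fg_gen) a = f (@FreeGroup [:: a] isT).
  case: a {rs} => i [] //; rewrite /letter_val /= -(morphgV fM).
  by congr (f _); apply: val_inj.
rewrite /fg_lift /= big_cons ga -[X in _ * X](IH rs') -fM.
congr (f _); apply: val_inj => /=.
by case: s rs {IH rs'} => //= b s /andP[/negPf ->].
Qed.

End FreeGroup.

Section Bijections.
Variable T : choiceType.

Record bij := Bij { bij_fun :> T -> T; _ : `[< bijective bij_fun >] }.
HB.instance Definition _ := [isSub for bij_fun].
HB.instance Definition _ := [Choice of bij by <:].

Lemma bijP (s : bij) : bijective s. Proof. exact/asboolP/(valP s). Qed.

Lemma bij_ext (s t : bij) : s =1 t -> s = t.
Proof. by move=> st; apply/val_inj/funext. Qed.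

Fact bij_inv_ex (s : bij) : exists g : T -> T, cancel s g /\ cancel g s.
Proof. by have [g] := bijP s; exists g. Qed.
Definition bij_invf (s : bij) := sval (cid (bij_inv_ex s)).
Lemma bij_invfP (s : bij) : cancel s (bij_invf s) /\ cancel (bij_invf s) s.
Proof. exact: svalP (cid (bij_inv_ex s)). Qed.
Fact bij_inv_subproof (s : bij) : `[< bijective (bij_invf s) >].
Proof. by apply/asboolP; have [? ?] := bij_invfP s; exists s. Qed.
Fact bij_mul_subproof (s t : bij) : `[< bijective (s \o t) >].
Proof. by apply/asboolP; apply: bij_comp; apply: bijP. Qed.
Fact bij_one_subproof : `[< bijective (@id T) >].
Proof. by apply/asboolP; exists id. Qed.

Definition bij_one := Bij bij_one_subproof.
Definition bij_mul (s t : bij) := Bij (bij_mul_subproof s t).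
Definition bij_inv (s : bij) := Bij (bij_inv_subproof s).

Fact bij_mulA : associative bij_mul. Proof. by move=> *; apply: bij_ext. Qed.
Fact bij_mul1 : left_id bij_one bij_mul.
Proof. by move=> *; apply: bij_ext. Qed.
Fact bij_mulr1 : right_id bij_one bij_mul.
Proof. by move=> *; apply: bij_ext. Qed.
Fact bij_mulV : left_inverse bij_one bij_inv bij_mul.
Proof. by move=> s; apply: bij_ext => x /=; rewrite (bij_invfP s).1. Qed.
Fact bij_mulrV : right_inverse bij_one bij_inv bij_mul.
Proof. by move=> s; apply: bij_ext => x /=; rewrite (bij_invfP s).2. Qed.
HB.instance Definition _ :=
  isGroup.Build bij bij_mulA bij_mul1 bij_mulr1 bij_mulV bij_mulrV.

Lemma bijE (s t : bij) x : (s * t) x = s (t x). Proof. by []. Qed.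
Lemma bijVK (s : bij) : cancel (s^-1)%g s.
Proof. by move=> x; rewrite -bijE mulgV. Qed.

End Bijections.

Definition is_subgroup (G : groupType) (H : set G) :=
  H 1 /\ forall x y, H x -> H y -> H (x * y^-1).

Definition gen_subgroup (G : groupType) (S : set G) : set G :=
  smallest (@is_subgroup G) S.

Section Automorphisms.
Variable G : groupType.

Definition is_gaut : pred (bij G) :=
  fun s => `[< {morph s : x y / x * y} >].

Record gaut := GAut { gaut_bij :> bij G; _ : is_gaut gaut_bij }.
HB.instance Definition _ := [isSub for gaut_bij].
HB.instance Definition _ := [Choice of gaut by <:].

Fact gaut_group_closed : group_closed is_gaut.
Proof.
split=> [|s t /asboolP sM /asboolP tM]; first exact/asboolP.
apply/asboolP => x y; rewrite !bijE -sM; congr (s _).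
by apply: (bij_inj (bijP t)); rewrite tM !bijVK.
Qed.
HB.instance Definition _ :=
  SubChoice_isSubGroup.Build (bij G) is_gaut gaut gaut_group_closed.

Lemma gautM (a : gaut) : {morph a : x y / x * y}.
Proof. exact/asboolP/(valP a). Qed.
Lemma gaut_ext (a b : gaut) : a =1 b -> a = b.
Proof. by move=> ab; apply/val_inj/bij_ext. Qed.
Lemma gautE (a b : gaut) x : (a * b) x = a (b x). Proof. by []. Qed.
Lemma gautVK (a : gaut) : cancel (a^-1)%g a. Proof. exact: bijVK. Qed.

(* Equality modulo inner automorphisms. *)
Definition inner_eq : rel gaut :=
  fun a b => `[< exists g : G, forall x, a x = b x ^ g >].

Fact inner_eq_refl : reflexive inner_eq.
Proof. by move=> a; apply/asboolP; exists 1 => x; rewrite conjg1. Qed.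
Fact inner_eq_sym : symmetric inner_eq.
Proof.
suff h a b : inner_eq a b -> inner_eq b a by move=> a b; apply/idP/idP; apply: h.
by move=> /asboolP[g ab]; apply/asboolP; exists g^-1 => x; rewrite ab conjgK.
Qed.
Fact inner_eq_trans : transitive inner_eq.
Proof.
move=> b a c /asboolP[g ab] /asboolP[h bc]; apply/asboolP; exists (h * g) => x.
by rewrite ab bc conjgM.
Qed.
Canonical inner_equiv :=
  EquivRel inner_eq inner_eq_refl inner_eq_sym inner_eq_trans.

Definition out := {eq_quot inner_equiv}%qT.
HB.instance Definition _ := Choice.on out.
HB.instance Definition _ := EqQuotient.on out.

Definition outcls (a : gaut) : out := \pi_out%qT a.

Lemma outclsK (d : out) : outcls (repr d) = d. Proof. exact: reprK. Qed.

Lemma outcls_eq a b :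
  outcls a = outcls b <-> exists g : G, forall x, a x = b x ^ g.
Proof.
by split=> [/eqmodP/asboolP|h]; last exact/eqmodP/asboolP.
Qed.

Lemma repr_outcls a : exists g : G, forall x, repr (outcls a) x = a x ^ g.
Proof. by apply/outcls_eq; rewrite outclsK. Qed.

Definition out_one : out := outcls 1.
Definition out_mul (c d : out) : out := outcls (repr c * repr d).
Definition out_inv (c : out) : out := outcls (repr c)^-1.

Lemma outcls_mul a b : out_mul (outcls a) (outcls b) = outcls (a * b).
Proof.
apply/outcls_eq; have [g ag] := repr_outcls a; have [h bh] := repr_outcls b.
exists (a h * g) => x; rewrite !gautE ag bh conjgM.
by rewrite /conjg !gautM (morphgV (@gautM a)).
Qed.

Fact out_mulA : associative out_mul.
Proof.
move=> a b c; rewrite -(outclsK a) -(outclsK b) -(outclsK c).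
by rewrite !outcls_mul mulgA.
Qed.
Fact out_mul1 : left_id out_one out_mul.
Proof. by move=> a; rewrite -(outclsK a) outcls_mul mul1g. Qed.
Fact out_mulr1 : right_id out_one out_mul.
Proof. by move=> a; rewrite -(outclsK a) outcls_mul mulg1. Qed.
Fact out_mulV : left_inverse out_one out_inv out_mul.
Proof.
by move=> a; rewrite /out_inv -{2}(outclsK a) outcls_mul mulVg.
Qed.
Fact out_mulrV : right_inverse out_one out_inv out_mul.
Proof.
by move=> a; rewrite /out_inv -{1}(outclsK a) outcls_mul mulgV.
Qed.
HB.instance Definition _ :=
  isGroup.Build out out_mulA out_mul1 out_mulr1 out_mulV out_mulrV.

Lemma outclsM : {morph outcls : a b / a * b}.
Proof. by move=> a b; rewrite -outcls_mul. Qed.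

End Automorphisms.

Definition Fr2 := freeGroup bool.
HB.instance Definition _ := Group.on Fr2.

Definition x1 : Fr2 := fg_gen false.
Definition x2 : Fr2 := fg_gen true.

(* The endomorphism of [Fr2] with [x1 |-> u] and [x2 |-> v]. *)
Definition F2_end (u v : Fr2) : Fr2 -> Fr2 :=
  fg_lift (fun b : bool => if b then v else u).

Lemma F2_end1 u v : F2_end u v x1 = u. Proof. exact: fg_lift_gen. Qed.
Lemma F2_end2 u v : F2_end u v x2 = v. Proof. exact: fg_lift_gen. Qed.

Lemma F2_endM u v : {morph F2_end u v : x y / x * y}.
Proof. exact: fg_liftM. Qed.

Lemma F2_ext (G : groupType) (f g : Fr2 -> G) :
  {morph f : x y / x * y} -> {morph g : x y / x * y} ->
  f x1 = g x1 -> f x2 = g x2 -> f =1 g.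
Proof.
move=> fM gM e1 e2 w; rewrite (fg_lift_unique fM) (fg_lift_unique gM).
by congr fg_lift; apply/funext; case.
Qed.

Lemma F2_endK u v : F2_end u v u = x1 -> F2_end u v v = x2 ->
  involutive (F2_end u v).
Proof.
move=> e1 e2; apply: F2_ext => //.
- by move=> x y; rewrite !F2_endM.
- by rewrite F2_end1.
- by rewrite F2_end2.
Qed.

Section Involution.
Variables (u v : Fr2) (e1 : F2_end u v u = x1) (e2 : F2_end u v v = x2).
Fact F2_inv_bij : `[< bijective (F2_end u v) >].
Proof. by apply/asboolP; exists (F2_end u v); apply: F2_endK. Qed.
Fact F2_inv_gaut : is_gaut (Bij F2_inv_bij).
Proof. by apply/asboolP; apply: F2_endM. Qed.
Definition F2_invol : gaut Fr2 := GAut F2_inv_gaut.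
End Involution.

Definition tau_aut : gaut Fr2 := F2_invol (F2_end2 x2 x1) (F2_end1 x2 x1).

Fact iota_subproof : F2_end x1^-1 x2 x1^-1 = x1.
Proof. by rewrite (morphgV (@F2_endM _ _)) F2_end1 invgK. Qed.
Definition iota_aut : gaut Fr2 := F2_invol iota_subproof (F2_end2 x1^-1 x2).

Lemma tau1 : tau_aut x1 = x2. Proof. exact: F2_end1. Qed.
Lemma tau2 : tau_aut x2 = x1. Proof. exact: F2_end2. Qed.
Lemma iota1 : iota_aut x1 = x1^-1. Proof. exact: F2_end1. Qed.
Lemma iota2 : iota_aut x2 = x2. Proof. exact: F2_end2. Qed.

Definition frakD : set (out Fr2) :=
  gen_subgroup [set outcls tau_aut; outcls iota_aut].

Section SpecialLinear.
Variables (n : nat) (K : fieldType).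

Record SL := MkSL { SLmx :> 'M[K]_n; _ : (\det SLmx == 1)%R }.
HB.instance Definition _ := [isSub for SLmx].
HB.instance Definition _ := [Choice of SL by <:].

Lemma detSL (A : SL) : (\det A = 1)%R. Proof. exact/eqP/(valP A). Qed.
Lemma SL_unit (A : SL) : (A : 'M_n) \in unitmx.
Proof. by rewrite unitmxE detSL unitr1. Qed.

Fact SL_one_subproof : (\det (1%:M : 'M[K]_n) == 1)%R.
Proof. by rewrite det1. Qed.
Fact SL_mul_subproof (A B : SL) : (\det (A *m B) == 1)%R.
Proof. by rewrite det_mulmx !detSL mulr1. Qed.
Fact SL_inv_subproof (A : SL) : (\det (invmx A) == 1)%R.
Proof. by rewrite det_inv detSL invr1. Qed.

Definition SL_one := MkSL SL_one_subproof.
Definition SL_mul A B := MkSL (SL_mul_subproof A B).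
Definition SL_inv A := MkSL (SL_inv_subproof A).

Fact SL_mulA : associative SL_mul.
Proof. by move=> A B C; apply/val_inj/mulmxA. Qed.
Fact SL_mul1 : left_id SL_one SL_mul.
Proof. by move=> A; apply/val_inj/mul1mx. Qed.
Fact SL_mulr1 : right_id SL_one SL_mul.
Proof. by move=> A; apply/val_inj/mulmx1. Qed.
Fact SL_mulV : left_inverse SL_one SL_inv SL_mul.
Proof. by move=> A; apply/val_inj/mulVmx/SL_unit. Qed.
Fact SL_mulrV : right_inverse SL_one SL_inv SL_mul.
Proof. by move=> A; apply/val_inj/mulmxV/SL_unit. Qed.
HB.instance Definition _ :=
  isGroup.Build SL SL_mulA SL_mul1 SL_mulr1 SL_mulV SL_mulrV.
HB.instance Definition _ := isPointed.Build SL 1.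

End SpecialLinear.

Local Open Scope ring_scope.

Section FunctionAlgebra.
Variables (T : pointedType) (K : comNzRingType) (A : comAlgType K).

Fact fct_scaleAl (k : K) (f g : T -> A) : k *: (f * g) = k *: f * g.
Proof. by apply/funext => x; apply: scalerAl. Qed.
HB.instance Definition _ :=
  GRing.Lmodule_isLalgebra.Build K (T -> A) fct_scaleAl.
HB.instance Definition _ := GRing.Lalgebra_isComAlgebra.Build K (T -> A).

End FunctionAlgebra.

Section Subalgebras.
Variables (K : nzRingType) (A : lalgType K).

Definition gen_subalg (S : set A) : set A :=
  smallest (fun B => GRing.subalg_closed (mem B)) S.

Lemma gen_subalg_sub (S : set A) : S `<=` gen_subalg S.
Proof. exact: sub_gen_smallest. Qed.

Lemma gen_subalg_closed (S : set A) : GRing.subalg_closed (mem (gen_subalg S)).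
Proof.
split=> [|k f g|f g].
- by apply/mem_set => B [[B1 _ _] _]; apply/set_mem/B1.
- move=> /set_mem Sf /set_mem Sg; apply/mem_set => B [cB SB].
  by have [_ + _] := cB; move=> /(_ k f g) h; apply/set_mem/h; apply/mem_set;
    [apply: Sf|apply: Sg].
- move=> /set_mem Sf /set_mem Sg; apply/mem_set => B [cB SB].
  by have [_ _] := cB; move=> /(_ f g) h; apply/set_mem/h; apply/mem_set;
    [apply: Sf|apply: Sg].
Qed.

Lemma gen_subalg_min (S B : set A) :
  GRing.subalg_closed (mem B) -> S `<=` B -> gen_subalg S `<=` B.
Proof. exact: smallest_sub. Qed.

End Subalgebras.

Section AlgebraAutomorphisms.
Variables (K : nzRingType) (A : lalgType K).

Definition is_algaut : pred (bij A) :=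
  fun s => `[< linear s /\ GRing.monoid_morphism s >].

Record algaut := AlgAut { algaut_bij :> bij A; _ : is_algaut algaut_bij }.
HB.instance Definition _ := [isSub for algaut_bij].
HB.instance Definition _ := [Choice of algaut by <:].

Fact algaut_group_closed : group_closed is_algaut.
Proof.
split=> [|s t /asboolP[sL [s1 sM]] /asboolP[tL [t1 tM]]]; first exact/asboolP.
have tI := bij_inj (bijP t).
apply/asboolP; split; [|split] => [k f g||f g]; rewrite !bijE.
- by rewrite -sL; congr (s _); apply: tI; rewrite tL !bijVK.
- by rewrite -[RHS]s1; congr (s _); apply: tI; rewrite t1 bijVK.
- by rewrite -sM; congr (s _); apply: tI; rewrite tM !bijVK.
Qed.
HB.instance Definition _ :=
  SubChoice_isSubGroup.Build (bij A) is_algaut algaut algaut_group_closed.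

Lemma algaut_ext (a b : algaut) : a =1 b -> a = b.
Proof. by move=> ab; apply/val_inj/bij_ext. Qed.
Lemma algautE (a b : algaut) x : (a * b)%g x = a (b x). Proof. by []. Qed.

End AlgebraAutomorphisms.

Section CharacterVariety.
Variable K : closedFieldType.

Definition pairs : Type := (SL 3 K * SL 3 K)%type.
HB.instance Definition _ := Pointed.on pairs.

(* The codomain is [K^o] because it is [K^o], not [K], that is a [K]-algebra
   in the library. *)
Definition entry (b : bool) (i j : 'I_3) : pairs -> K^o :=
  fun g => (if b then g.2 else g.1) i j.

(* Since [K] is infinite and [pairs] is an affine variety, regular functions
   are the polynomials in the matrix entries, viewed as functions. *)
Definition regular : set (pairs -> K^o) :=
  gen_subalg [set f | exists b i j, f = entry b i j].

Definition conj_invariant (f : pairs -> K^o) :=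
  forall (g : pairs) (h : SL 3 K), f (g.1 ^ h, g.2 ^ h)%g = f g.

Definition is_CX : pred (pairs -> K^o) :=
  fun f => `[< regular f /\ conj_invariant f >].

Record CX := MkCX { CXfun :> pairs -> K^o; _ : is_CX CXfun }.
HB.instance Definition _ := [isSub for CXfun].
HB.instance Definition _ := [Choice of CX by <:].

Fact CX_closed : GRing.subalg_closed is_CX.
Proof.
have [r1 rL rM] := gen_subalg_closed [set f | exists b i j, f = entry b i j].
split=> [|k f f' /asboolP[rf hf] /asboolP[rf' hf']
         |f f' /asboolP[rf hf] /asboolP[rf' hf']]; apply/asboolP.
- by split; [apply/set_mem/r1|].
- split; first by apply/set_mem/rL; apply/mem_set.
  by move=> g h; rewrite /= /GRing.scale /GRing.add /= hf hf'.
- split; first by apply/set_mem/rM; apply/mem_set.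
  by move=> g h; rewrite /= /GRing.mul /= hf hf'.
Qed.
HB.instance Definition _ :=
  GRing.SubChoice_isSubAlgebra.Build K (pairs -> K^o) is_CX CX CX_closed.
HB.instance Definition _ :=
  GRing.SubNzRing_isSubComNzRing.Build (pairs -> K^o) is_CX CX.

Lemma CX_regular (f : CX) : regular f. Proof. by case/asboolP: (valP f). Qed.
Lemma CX_inv (f : CX) : conj_invariant f. Proof. by case/asboolP: (valP f). Qed.
Lemma CX_ext (f f' : CX) : f =1 f' -> f = f'.
Proof. by move=> e; apply/val_inj/funext. Qed.

(* [wordval g w] is the word [w] with [x1], [x2] replaced by [g.1], [g.2]. *)
Definition wordval (g : pairs) : Fr2 -> SL 3 K :=
  fg_lift (fun b : bool => if b then g.2 else g.1).

Lemma wordvalM g : {morph wordval g : u v / (u * v)%g}.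
Proof. exact: fg_liftM. Qed.
Lemma wordval1 g : wordval g x1 = g.1. Proof. exact: fg_lift_gen. Qed.
Lemma wordval2 g : wordval g x2 = g.2. Proof. exact: fg_lift_gen. Qed.

Lemma wordvalJ (g : pairs) h w :
  wordval (g.1 ^ h, g.2 ^ h)%g w = (wordval g w ^ h)%g.
Proof.
apply: (F2_ext (f := wordval _) (g := fun w => (wordval g w ^ h)%g)).
- exact: wordvalM.
- by move=> u v; rewrite wordvalM conjMg.
- by rewrite !wordval1.
- by rewrite !wordval2.
Qed.

Lemma regular_const (c : K) : regular (fun=> c).
Proof.
have [r1 rL _] := gen_subalg_closed [set f | exists b i j, f = entry b i j].
have h0 : (0 : pairs -> K^o) \in regular.
  by have := rL (-1) _ _ r1 r1; rewrite scaleN1r addNr.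
have := rL c _ _ r1 h0; rewrite addr0 => /set_mem.
by congr regular; apply/funext => g; rewrite /GRing.scale /= /GRing.scale /= mulr1.
Qed.

Lemma regularD f g : regular f -> regular g -> regular (fun x => f x + g x).
Proof.
have [_ rL _] := gen_subalg_closed [set f | exists b i j, f = entry b i j].
move=> rf rg; have := rL 1 f g (mem_set rf) (mem_set rg).
by rewrite scale1r => /set_mem.
Qed.

Lemma regularM f g : regular f -> regular g -> regular (fun x => f x * g x).
Proof.
have [_ _ rM] := gen_subalg_closed [set f | exists b i j, f = entry b i j].
by move=> rf rg; have := rM f g (mem_set rf) (mem_set rg); move=> /set_mem.
Qed.

Lemma regular_entry b i j : regular (entry b i j).
Proof. by apply: gen_subalg_sub; exists b, i, j. Qed.

Lemma regular_sum (I : Type) (r : seq I) (F : I -> pairs -> K^o) :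
  (forall i, regular (F i)) -> regular (fun g => \sum_(i <- r) F i g).
Proof.
move=> rF; elim: r => [|i r IH].
  rewrite [X in regular X](_ : _ = fun=> 0) ?funeqE => [|g].
    exact: regular_const.
  by rewrite big_nil.
rewrite [X in regular X](_ : _ = fun g => F i g + \sum_(i <- r) F i g).
  exact: regularD.
by apply/funext => g; rewrite big_cons.
Qed.

Lemma regular_prod (I : Type) (r : seq I) (F : I -> pairs -> K^o) :
  (forall i, regular (F i)) -> regular (fun g => \prod_(i <- r) F i g).
Proof.
move=> rF; elim: r => [|i r IH].
  rewrite [X in regular X](_ : _ = fun=> 1) ?funeqE => [|g].
    exact: regular_const.
  by rewrite big_nil.
rewrite [X in regular X](_ : _ = fun g => F i g * \prod_(i <- r) F i g).
  exact: regularM.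
by apply/funext => g; rewrite big_cons.
Qed.

Lemma regular_inv b i j :
  regular (fun g : pairs => ((if b then g.2 else g.1)^-1)%g i j).
Proof.
set A : pairs -> SL 3 K := fun g => if b then g.2 else g.1.
rewrite [X in regular X](_ : _ = fun g : pairs => (-1) ^+ (j + i) *
   \sum_(s : 'S_2) (-1) ^+ s * \prod_k A g (lift j k) (lift i (s k))).
  apply: regularM; first exact: regular_const.
  apply: regular_sum => s; apply: regularM; first exact: regular_const.
  by apply: regular_prod => k; apply: regular_entry.
apply/funext => g; rewrite -/(A g).
change ((A g)^-1)%g with (SL_inv (A g)).
rewrite /= /invmx SL_unit detSL invr1 scale1r mxE /cofactor; congr (_ * _).
by apply: eq_bigr => s _; congr (_ * _); apply: eq_bigr => k _; rewrite !mxE.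
Qed.

Lemma regular_wordval w i j : regular (fun g => wordval g w i j).
Proof.
rewrite /wordval /fg_lift; elim: (val w) i j => [|a s IH] i j.
  rewrite [X in regular X](_ : _ = fun=> (1%:M : 'M_3) i j) ?funeqE => [|g].
    exact: regular_const.
  by rewrite big_nil.
rewrite [X in regular X](_ : _ = fun g : pairs => \sum_k
    letter_val (fun b : bool => if b then g.2 else g.1) a i k *
    (\prod_(b <- s) letter_val (fun b : bool => if b then g.2 else g.1) b)%g k j).
  apply: regular_sum => k; apply: regularM; last exact: IH.
  case: a => b []; rewrite /letter_val /=; first exact: regular_inv.
  exact: regular_entry.
by apply/funext => g; rewrite big_cons mxE.
Qed.

Fact trw_subproof w : is_CX (fun g => \tr (wordval g w)).
Proof.
apply/asboolP; split; first by apply: regular_sum => i; apply: regular_wordval.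
move=> g h; rewrite wordvalJ.
change (wordval g w ^ h)%g with (SL_mul (SL_inv h) (SL_mul (wordval g w) h)).
by rewrite /= mxtrace_mulC -mulmxA mulmxV ?mulmx1 ?SL_unit.
Qed.
Definition trw (w : Fr2) : CX := MkCX (trw_subproof w).

Section Action.

Definition pullback (a : gaut Fr2) (g : pairs) : pairs :=
  (wordval g (a x1), wordval g (a x2)).

Lemma wordval_pullback a g w : wordval (pullback a g) w = wordval g (a w).
Proof.
apply: (F2_ext (f := wordval _) (g := wordval g \o a)).
- exact: wordvalM.
- by move=> u v /=; rewrite gautM wordvalM.
- by rewrite wordval1.
- by rewrite wordval2.
Qed.

Fact act_subproof (a : gaut Fr2) (f : CX) : is_CX (f \o pullback a).
Proof.
apply/asboolP; split; last first.
  by move=> g h; rewrite /= /pullback !wordvalJ; apply: (CX_inv f (_, _)).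
have := CX_regular f; move: (f : pairs -> K^o) => {}f.
pose B : set (pairs -> K^o) := fun f => regular (fun g => f (pullback a g)).
suff h : regular `<=` B by exact: h.
apply: gen_subalg_min.
  split=> [|k f1 f2|f1 f2].
  - by apply/mem_set; apply: regular_const.
  - move=> /set_mem r1 /set_mem r2; apply/mem_set.
    exact: (regularD (regularM (regular_const k) r1) r2).
  - by move=> /set_mem r1 /set_mem r2; apply/mem_set; apply: regularM.
move=> _ [b [i [j ->]]]; rewrite /= /entry /=.
by case: b; apply: regular_wordval.
Qed.

Definition act_fun (a : gaut Fr2) (f : CX) : CX := MkCX (act_subproof a f).

Lemma act_fun_trw a w : act_fun a (trw w) = trw (a w).
Proof. by apply: CX_ext => g /=; rewrite wordval_pullback. Qed.

Lemma act_funM a b f : act_fun (a * b)%g f = act_fun a (act_fun b f).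
Proof.
by apply: CX_ext => g /=; congr (f _); rewrite /pullback !wordval_pullback.
Qed.

Lemma act_fun1 f : act_fun 1%g f = f.
Proof.
by apply: CX_ext => g /=; rewrite /pullback wordval1 wordval2 -surjective_pairing.
Qed.

Lemma act_fun_inner (a b : gaut Fr2) (h : Fr2) :
  (forall x, a x = (b x ^ h)%g) -> act_fun a =1 act_fun b.
Proof.
move=> ab f; apply: CX_ext => g /=; rewrite /pullback !ab.
have wJ w : wordval g (w ^ h)%g = (wordval g w ^ wordval g h)%g.
  by rewrite /conjg !wordvalM (morphgV (@wordvalM g)).
by rewrite !wJ (CX_inv f (_, _)).
Qed.

Fact act_bij a : `[< bijective (act_fun a) >].
Proof.
apply/asboolP; exists (act_fun a^-1%g) => f.
- by rewrite -act_funM mulVg act_fun1.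
- by rewrite -act_funM mulgV act_fun1.
Qed.
Fact act_algaut a : is_algaut (Bij (act_bij a)).
Proof.
by apply/asboolP; split; [|split] => [k f g||f g]; apply: CX_ext.
Qed.

(* The action of [out Fr2] on [CX]: it does not depend on representatives by
   [act_outcls], and it is determined on traces of words by [act_trw]. *)
Definition out_act (d : out Fr2) : algaut CX := AlgAut (act_algaut (repr d)).

Lemma act_outcls a f : out_act (outcls a) f = act_fun a f.
Proof. by have [h e] := repr_outcls a; apply: (act_fun_inner e). Qed.

Lemma act_trw a w : out_act (outcls a) (trw w) = trw (a w).
Proof. by rewrite act_outcls act_fun_trw. Qed.

Lemma actM : {morph out_act : c d / (c * d)%g}.
Proof.
move=> c d; apply: algaut_ext => f.
rewrite -{1}(outclsK c) -{1}(outclsK d) -outclsM act_outcls act_funM.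
by rewrite -!act_outcls !outclsK.
Qed.

End Action.

(* [tmi] is the trace with index [-i]. *)
Definition t1 := trw x1.
Definition tm1 := trw x1^-1%g.
Definition t2 := trw x2.
Definition tm2 := trw x2^-1%g.
Definition t3 := trw (x1 * x2)%g.
Definition tm3 := trw (x1^-1 * x2^-1)%g.
Definition t4 := trw (x1 * x2^-1)%g.
Definition tm4 := trw (x1^-1 * x2)%g.
Definition t5 := trw (x1 * x2 * x1^-1 * x2^-1)%g.

Definition indep_gens : set CX := [set t1; tm1; t2; tm2; t3; tm3; t4; tm4].
Definition all_gens : set CX := indep_gens `|` [set t5].

Definition polyR : set CX := gen_subalg indep_gens.

Definition is_RX : pred CX := fun f => `[< polyR f >].

Record RX := MkRX { RXval :> CX; _ : is_RX RXval }.
HB.instance Definition _ := [isSub for RXval].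
HB.instance Definition _ := [Choice of RX by <:].
Fact RX_closed : GRing.subalg_closed is_RX.
Proof. exact: gen_subalg_closed. Qed.
HB.instance Definition _ :=
  GRing.SubChoice_isSubAlgebra.Build K CX is_RX RX RX_closed.
HB.instance Definition _ := GRing.SubNzRing_isSubComNzRing.Build CX is_RX RX.

(* The group of automorphisms of [RX] induced by [frakD]. *)
Definition frakD_RX : set (algaut RX) :=
  [set s : algaut RX |
    exists2 d, frakD d & forall f : RX, s f = out_act d f :> CX].

(* Each [out_act d] is injective, so this says that it permutes [S]. *)
Definition frakD_permutes (S : set CX) := forall d, frakD d -> out_act d @` S = S.

End CharacterVariety.

Arguments out_act {K} d.
Arguments polyR {K} _.
Arguments frakD_RX {K} _.
Arguments frakD_permutes {K} S.
Arguments indep_gens K _ : clear implicits.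
Arguments all_gens K _ : clear implicits.

(* Main.v *)
Require Import Defs.
From mathcomp Require Import all_boot all_order all_algebra all_fingroup all_solvable.
From mathcomp Require Import boolp classical_sets functions.
From mathcomp Require Import reals complex.

(** On the eight traces [t1], [tm1], ..., [t4], [tm4] the two generators of [frakD],
called [out_tau] and [out_iota] below, act by the permutations

  - [out_tau]  : t1 <-> t2, tm1 <-> tm2, t4 <-> tm4, with t3 and tm3 fixed;
  - [out_iota] : t1 <-> tm1, t3 <-> tm4, tm3 <-> t4, with t2 and tm2 fixed,

because a trace depends only on the cyclic class of a word ([tau_gens],
[iota_gens]).  Hence [frakD] permutes the eight traces and preserves the
subalgebra that they generate.

In Out(F_2) one has [out_tau ^+ 2 = 1], and [out_rot = out_tau * out_iota]
satisfies [out_rot ^+ 4 = 1] and [out_rot ^ out_tau = out_rot^-1].  These are the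
relations of the dihedral group of order 8, whose elements are exactly the eight
normal forms [x ^+ i * y ^+ j] ([D8_words]); so sending normal forms to normal
forms is a morphism from the dihedral group onto the group induced on the
subalgebra ([D8_morphism]).  It is injective because [out_rot] permutes t1, tm2,
tm1, t2 in a 4-cycle: the images of t1 and t2 determine the normal form as soon as
these four traces are distinct functions ([dihedral_word_inj]).

Finally [out_tau] sends t5, the trace of the commutator of x1 and x2, to the trace
[tm5] of the inverse commutator, and tm5 is none of the nine generators
([tm5_notin_gens]).  A [frakD]-stable set of generators therefore cannot contain
t5 ([t5_notin_stable]).

The two facts about distinct functions are read off at one pair of integer
matrices of determinant 1, where t1, tm1, t2, tm2, t5, tm5 take the values
-1, 0, 2, 1, 0, -2 and the four remaining traces are equal to -1
([sample_values]); integers stay distinct in the field, which has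
characteristic 0. *)

Set Implicit Arguments.
Unset Strict Implicit.
Unset Printing Implicit Defensive.

Import GRing.Theory Num.Theory.

Local Open Scope classical_set_scope.

(** * Traces at a pair of integer matrices *)

Section IntegerMatrices.
Local Open Scope ring_scope.
Variable K : numClosedFieldType.

(** Integer matrices of size 3 are lists of rows, so that their products,
determinants and traces can be computed; [mx3] maps them to matrices over [K].
Missing entries are read as 0. *)
Definition ent (s : seq (seq int)) (i j : nat) : int := nth 0 (nth [::] s i) j.

Definition mx3 (s : seq (seq int)) : 'M[K]_3 :=
  \matrix_(i < 3, j < 3) (ent s i j)%:~R.

Definition mul3 (s t : seq (seq int)) : seq (seq int) :=
  mkseq (fun i => mkseq (fun j =>
    ent s i 0 * ent t 0 j + ent s i 1 * ent t 1 j + ent s i 2 * ent t 2 j) 3) 3.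

Definition det3 (s : seq (seq int)) : int :=
  ent s 0 0 * (ent s 1 1 * ent s 2 2 - ent s 1 2 * ent s 2 1)
  - ent s 0 1 * (ent s 1 0 * ent s 2 2 - ent s 1 2 * ent s 2 0)
  + ent s 0 2 * (ent s 1 0 * ent s 2 1 - ent s 1 1 * ent s 2 0).

Lemma mul_mx3 s t : mx3 s *m mx3 t = mx3 (mul3 s t).
Proof.
apply/matrixP => i j; rewrite !mxE !big_ord_recl big_ord0 !mxE /= addr0.
by rewrite /ent !nth_mkseq // -!intrM -!intrD addrA.
Qed.

Lemma tr_mx3 s : \tr (mx3 s) = (ent s 0 0 + ent s 1 1 + ent s 2 2)%:~R.
Proof. by rewrite /mxtrace !big_ord_recl big_ord0 !mxE addr0 addrA !intrD. Qed.

Lemma det_mx3 s : \det (mx3 s) = (det3 s)%:~R.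
Proof.
rewrite (expand_det_row _ 0) !big_ord_recl big_ord0 /cofactor.
rewrite !(expand_det_row _ 0) !big_ord_recl !big_ord0 /cofactor !det_mx11 !mxE /=.
rewrite /bump /= !addnE /=.
rewrite /det3 !(rmorphD, rmorphN, rmorphM) /=.
rewrite !expr0 !mul1r !addr0 !expr1 sqrrN expr1n !mulN1r !mul1r !mulrN.
by rewrite addrA.
Qed.

Lemma mx3_id : mx3 [:: [:: 1; 0; 0]; [:: 0; 1; 0]; [:: 0; 0; 1]] = 1%:M.
Proof.
by apply/matrixP => -[[|[|[|//]]] ?] [[|[|[|//]]] ?]; rewrite !mxE.
Qed.

Fact sl3_subproof s : det3 s = 1 -> \det (mx3 s) == 1.
Proof. by move=> ds; rewrite det_mx3 ds. Qed.
Definition sl3 s (ds : det3 s = 1) : SL 3 K := MkSL (sl3_subproof ds).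

Lemma sl3V s t (ds : det3 s = 1) (dt : det3 t = 1) :
  mul3 s t = [:: [:: 1; 0; 0]; [:: 0; 1; 0]; [:: 0; 0; 1]] ->
  ((sl3 ds)^-1)%g = sl3 dt.
Proof.
move=> st; apply: (mulgI (sl3 ds)); rewrite mulgV; apply: val_inj.
change (1%:M = mx3 s *m mx3 t); by rewrite mul_mx3 st mx3_id.
Qed.

(** Two integer matrices of determinant 1, followed each by its inverse.  Any pair
that separates t1, tm1, t2, tm2 from one another, and tm5 from the nine generators,
would do. *)
Definition mA := [:: [:: 0; 1; 0]; [:: 0; 0; 1]; [:: 1; 0; -1 : int]].
Definition mA' := [:: [:: 0; 1; 1]; [:: 1; 0; 0]; [:: 0; 1; 0 : int]].
Definition mB := [:: [:: 0; -1; 0]; [:: 0; 1; -1]; [:: 1; 0; 1 : int]].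
Definition mB' := [:: [:: 1; 1; 1]; [:: -1; 0; 0]; [:: -1; -1; 0 : int]].

Fact det_mA : det3 mA = 1. Proof. by []. Qed.
Fact det_mA' : det3 mA' = 1. Proof. by []. Qed.
Fact det_mB : det3 mB = 1. Proof. by []. Qed.
Fact det_mB' : det3 mB' = 1. Proof. by []. Qed.

Definition sample_pair : pairs K := (sl3 det_mA, sl3 det_mB).

(** At the sample pair, the word [w] takes the integer matrix [s] as its value. *)
Definition evaluates_to (w : Fr2) (s : seq (seq int)) :=
  val (wordval sample_pair w) = mx3 s.

Lemma evaluates_x1 : evaluates_to x1 mA.
Proof. by rewrite /evaluates_to wordval1. Qed.
Lemma evaluates_x2 : evaluates_to x2 mB.
Proof. by rewrite /evaluates_to wordval2. Qed.
Lemma evaluates_x1V : evaluates_to x1^-1%g mA'.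
Proof.
by rewrite /evaluates_to (morphgV (@wordvalM _ _)) wordval1 (sl3V det_mA det_mA').
Qed.
Lemma evaluates_x2V : evaluates_to x2^-1%g mB'.
Proof.
by rewrite /evaluates_to (morphgV (@wordvalM _ _)) wordval2 (sl3V det_mB det_mB').
Qed.
Lemma evaluatesM u v s t :
  evaluates_to u s -> evaluates_to v t -> evaluates_to (u * v)%g (mul3 s t).
Proof.
rewrite /evaluates_to wordvalM => us vt.
change (val (wordval sample_pair u) *m val (wordval sample_pair v) = mx3 (mul3 s t)).
by rewrite us vt mul_mx3.
Qed.

Lemma trw_sample w s : evaluates_to w s ->
  trw K w sample_pair = (ent s 0 0 + ent s 1 1 + ent s 2 2)%:~R.
Proof. by move=> ws; rewrite -tr_mx3 -ws. Qed.

(** The trace of the inverse of the commutator of [x1] and [x2]: it would carry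
the index -5. *)
Definition tm5 := trw K (x2 * x1 * x2^-1 * x1^-1)%g.

Lemma sample_values :
  [/\ [/\ t1 K sample_pair = (-1)%:~R, tm1 K sample_pair = 0%:~R,
          t2 K sample_pair = 2%:~R & tm2 K sample_pair = 1%:~R],
      [/\ t3 K sample_pair = (-1)%:~R, tm3 K sample_pair = (-1)%:~R,
          t4 K sample_pair = (-1)%:~R & tm4 K sample_pair = (-1)%:~R],
      t5 K sample_pair = 0%:~R &
      tm5 sample_pair = (-2)%:~R].
Proof.
have e1 := evaluates_x1; have e2 := evaluates_x2.
have f1 := evaluates_x1V; have f2 := evaluates_x2V.
by do ![split]; [rewrite (trw_sample e1)|rewrite (trw_sample f1)
  |rewrite (trw_sample e2)|rewrite (trw_sample f2)
  |rewrite (trw_sample (evaluatesM e1 e2))|rewrite (trw_sample (evaluatesM f1 f2))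
  |rewrite (trw_sample (evaluatesM e1 f2))|rewrite (trw_sample (evaluatesM f1 e2))
  |rewrite (trw_sample (evaluatesM (evaluatesM (evaluatesM e1 e2) f1) f2))
  |rewrite (trw_sample (evaluatesM (evaluatesM (evaluatesM e2 e1) f2) f1))].
Qed.

Lemma tm5_notin_gens : ~ all_gens K tm5.
Proof.
have [[v1 v2 v3 v4] [v5 v6 v7 v8] v9 v] := sample_values.
have ne (f : CX K) (m : int) : f sample_pair = m%:~R -> m != -2 -> tm5 <> f.
  move=> fm + e; rewrite -(eqr_int K) -fm -e => /eqP; exact.
case=> [[[[[[[[|]|]|]|]|]|]|]|];
  [exact: ne v1 _|exact: ne v2 _|exact: ne v3 _|exact: ne v4 _|exact: ne v5 _
  |exact: ne v6 _|exact: ne v7 _|exact: ne v8 _|exact: ne v9 _].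
Qed.

End IntegerMatrices.

Local Open Scope group_scope.

(** * Normal forms in the dihedral group of order 8 *)

Section DihedralWords.
Variables (G : groupType) (x y : G).

(** The element of [G] with normal form [p = (i, j)]. *)
Definition dihedral_word (p : 'I_4 * bool) : G := x ^+ p.1 * y ^+ p.2.

(** The multiplication of normal forms that the dihedral relations impose: [y]
inverts [x], hence turns the exponent [k] into [4 - k]. *)
Definition dihedral_mul (p q : 'I_4 * bool) : 'I_4 * bool :=
  (inord ((p.1 + (if p.2 then 4 - q.1 else q.1)) %% 4), p.2 (+) q.2).

Hypotheses (x4 : x ^+ 4 = 1) (y2 : y ^+ 2 = 1) (xy : x ^ y = x^-1).

Lemma dihedral_wordM p q :
  dihedral_word (dihedral_mul p q) = dihedral_word p * dihedral_word q.
Proof.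
have x_mod n : x ^+ (n %% 4) = x ^+ n.
  by rewrite [in RHS](divn_eq n 4) expgD mulnC expgM x4 expg1n mul1g.
have yx (i : 'I_4) : y * x ^+ i = x ^+ (4 - i) * y.
  have -> : x ^+ (4 - i) = x ^- i.
    by apply: (mulIg (x ^+ i)); rewrite -expgD subnK ?x4 ?mulVg// ltnW.
  by rewrite [RHS]conjgC conjVg conjXg xy expgVn invgK.
case: p q => [i b] [j c]; rewrite /dihedral_word /dihedral_mul /=.
rewrite inordK ?ltn_pmod// x_mod expgD.
case: b => /=; last by rewrite !mulg1 mulgA.
rewrite -!mulgA (mulgA y) yx; congr (_ * _).
by case: c; rewrite -mulgA; congr (_ * _); [apply: esym | rewrite mulg1].
Qed.
End DihedralWords.

(** The group ['D_8] has generators satisfying the dihedral relations, and its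
elements are their eight normal forms, without repetition. *)
Lemma D8_words : exists xy : 'D_8%type * 'D_8%type,
  [/\ bijective (dihedral_word xy.1 xy.2),
      xy.1 ^+ 4 = 1, xy.2 ^+ 2 = 1 & xy.1 ^ xy.2 = xy.1^-1].
Proof.
have /existsP[[x y] /=] := isoGrp_hom (@Grp_2dihedral 3 isT).
case/eqP=> defD x4 y2 xy; exists (x, y); split=> //=.
(* Every element is a normal form; counting then gives injectivity. *)
have surj : dihedral_word x y @: finset.setT = finset.setT.
  apply/setP => g; rewrite [RHS]inE; apply/imsetP.
  have : g \in (<[x]> <*> <[y]>)%g by rewrite defD inE.
  rewrite norm_joinEr ?norms_cycle ?xy ?groupV ?cycle_id //.
  case/imset2P => _ _ /cycleP[i ->] /cycleP[j ->] ->.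
  exists (inord (i %% 4), odd j); rewrite ?inE // /dihedral_word /=.
  by rewrite inordK ?ltn_pmod// -modn2 !expg_mod.
have cD : #|{: 'D_8%type}| = #|{: 'I_4 * bool}|.
  by rewrite -[LHS]cardsT (@card_2dihedral 3) // card_prod card_ord card_bool.
apply: inj_card_bij; last by rewrite cD.
have /imset_injP inj : #|dihedral_word x y @: finset.setT| == #|[set: 'I_4 * bool]%SET|.
  by rewrite surj !cardsT cD.
by move=> p q; apply: inj; rewrite inE.
Qed.

(** Two elements of a possibly infinite group that satisfy the dihedral relations
define a morphism from ['D_8], whose image consists of their normal forms. *)
Lemma D8_morphism (G : groupType) (a b : G) :
  a ^+ 4 = 1 -> b ^+ 2 = 1 -> a ^ b = a^-1 ->
  exists phi : 'D_8%type -> G,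
    {morph phi : g h / g * h} /\ range phi = range (dihedral_word a b) /\
    (injective (dihedral_word a b) -> injective phi).
Proof.
move=> a4 b2 ab; have [[x y] /= [[psi wK psiK] x4 y2 xy]] := D8_words.
exists (dihedral_word a b \o psi); split; [|split].
- move=> g h; rewrite /= -dihedral_wordM //; congr (dihedral_word a b _).
  by apply: (can_inj wK); rewrite dihedral_wordM // !psiK.
- apply/seteqP; split=> _ [g _ <-]; first by exists (psi g).
  by exists (dihedral_word x y g); rewrite //= wK.
- by move=> inj; apply: inj_comp => //; apply: can_inj psiK.
Qed.

(** * The relations in the outer automorphism group *)

(** The generators of [frakD], and the product that plays the part of the rotation
of order 4. *)
Definition out_tau : out Fr2 := outcls tau_aut.
Definition out_iota : out Fr2 := outcls iota_aut.
Definition out_rot : out Fr2 := out_tau * out_iota.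

Lemma out_tau2 : out_tau ^+ 2 = 1.
Proof.
rewrite expg2 -outclsM; congr outcls; apply: gaut_ext.
by apply: F2_ext => [u v|u v||]; rewrite ?gautM // gautE ?(tau1, tau2).
Qed.

Lemma out_iota2 : out_iota ^+ 2 = 1.
Proof.
rewrite expg2 -outclsM; congr outcls; apply: gaut_ext.
by apply: F2_ext => [u v|u v||];
  rewrite ?gautM // gautE ?(iota1, iota2) ?(morphgV (@gautM _ _)) ?iota1 ?invgK.
Qed.

Lemma out_rot4 : out_rot ^+ 4 = 1.
Proof.
have -> : out_rot = outcls (tau_aut * iota_aut) by rewrite /out_rot outclsM.
rewrite -[4]/(2 * 2)%N expgM !expg2.
rewrite -(outclsM (tau_aut * iota_aut)) -outclsM; congr outcls; apply: gaut_ext.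
have autV := morphgV (@gautM Fr2 _).
apply: F2_ext; [exact: gautM|by []|rewrite !gautE|rewrite !gautE];
  by rewrite !(iota1, iota2, tau1, tau2, autV, invgK).
Qed.

Lemma out_tauM_rot : out_tau * out_rot = out_iota.
Proof. by rewrite mulgA -expg2 out_tau2 mul1g. Qed.

Lemma out_rotJ_tau : out_rot ^ out_tau = out_rot^-1.
Proof.
apply: (mulgI out_rot); rewrite mulgV /conjg.
have -> : out_tau^-1 = out_tau.
  by apply: (mulgI out_tau); rewrite mulgV -expg2 out_tau2.
rewrite (mulgA out_tau) out_tauM_rot mulgA -(mulgA out_tau).
by rewrite -expg2 out_iota2 mulg1 -expg2 out_tau2.
Qed.

Lemma frakD_tau : frakD out_tau.
Proof. by apply: sub_gen_smallest; left. Qed.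
Lemma frakD_iota : frakD out_iota.
Proof. by apply: sub_gen_smallest; right. Qed.

Lemma frakD_subgroup : is_subgroup frakD.
Proof.
split=> [B [[B1 _] _] //|c d Dc Dd B [BB SB]]; apply: BB.2.
- exact: Dc.
- exact: Dd.
Qed.

Lemma frakD1 : frakD 1. Proof. exact: frakD_subgroup.1. Qed.
Lemma frakDV d : frakD d -> frakD d^-1.
Proof.
by move=> Dd; rewrite -[d^-1]mul1g; apply: frakD_subgroup.2 => //; apply: frakD1.
Qed.
Lemma frakDM c d : frakD c -> frakD d -> frakD (c * d).
Proof.
by move=> Dc Dd; rewrite -[d]invgK; apply: frakD_subgroup.2 => //; apply: frakDV.
Qed.
Lemma frakDX d n : frakD d -> frakD (d ^+ n).
Proof.
by move=> Dd; elim: n => [|n IH]; [exact: frakD1 | rewrite expgS; apply: frakDM].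
Qed.

Lemma frakD_rot : frakD out_rot.
Proof. exact: frakDM frakD_tau frakD_iota. Qed.

Lemma frakD_ind (B : set (out Fr2)) :
  is_subgroup B -> B out_tau -> B out_iota -> frakD `<=` B.
Proof. by move=> sB Bt Bi; apply: smallest_sub => // _ [->|->]. Qed.

(** * The action on traces *)

Section Action.
Variable K : numClosedFieldType.
Local Notation act := (@out_act K).

Lemma act1 f : act 1 f = f.
Proof. by rewrite (morphg1 (@Defs.actM K)). Qed.

Lemma actK d : cancel (act d) (act d^-1).
Proof. by move=> f; rewrite -algautE -Defs.actM mulVg act1. Qed.

Lemma actVK d : cancel (act d^-1) (act d).
Proof. by move=> f; rewrite -algautE -Defs.actM mulgV act1. Qed.

Lemma trw_cyclic u v : trw K (u * v) = trw K (v * u).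
Proof.
apply: CX_ext => g /=; rewrite !wordvalM.
change (\tr (val (wordval g u) *m val (wordval g v)) =
  \tr (val (wordval g v) *m val (wordval g u)))%R.
exact: mxtrace_mulC.
Qed.

Lemma tau_act w : act out_tau (trw K w) = trw K (F2_end x2 x1 w).
Proof. exact: act_trw. Qed.
Lemma iota_act w : act out_iota (trw K w) = trw K (F2_end x1^-1 x2 w).
Proof. exact: act_trw. Qed.

Let F2V u v := morphgV (@F2_endM u v).
Let F2E := (F2_endM, F2V, F2_end1, F2_end2, @invgK Fr2).

Lemma tau_gens :
  [/\ [/\ act out_tau (t1 K) = t2 K, act out_tau (tm1 K) = tm2 K,
          act out_tau (t2 K) = t1 K & act out_tau (tm2 K) = tm1 K],
      [/\ act out_tau (t3 K) = t3 K, act out_tau (tm3 K) = tm3 K,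
          act out_tau (t4 K) = tm4 K & act out_tau (tm4 K) = t4 K] &
      act out_tau (t5 K) = tm5 K].
Proof.
rewrite /t1 /tm1 /t2 /tm2 /t3 /tm3 /t4 /tm4 /t5 /tm5 !tau_act !F2E.
by do ![split => //]; rewrite [LHS]trw_cyclic.
Qed.

Lemma iota_gens :
  [/\ [/\ act out_iota (t1 K) = tm1 K, act out_iota (tm1 K) = t1 K,
          act out_iota (t2 K) = t2 K & act out_iota (tm2 K) = tm2 K] &
      [/\ act out_iota (t3 K) = tm4 K, act out_iota (tm3 K) = t4 K,
          act out_iota (t4 K) = tm3 K & act out_iota (tm4 K) = t3 K]].
Proof.
rewrite /t1 /tm1 /t2 /tm2 /t3 /tm3 /t4 /tm4 !iota_act !F2E.
by [].
Qed.

Lemma permutes_subgroup (S : set (CX K)) :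
  is_subgroup [set d | act d @` S = S].
Proof.
split=> [|c d cS dS].
  apply/seteqP; split=> [_ [f Sf <-]|f Sf]; first by rewrite act1.
  by exists f; rewrite ?act1.
apply/seteqP; split=> [_ [f Sf <-]|f Sf].
  rewrite Defs.actM algautE; move: Sf; rewrite -{1}dS => -[g Sg <-].
  by rewrite actK -cS; exists g.
move: Sf; rewrite -{1}cS => -[g Sg <-]; exists (act d g).
  by rewrite -dS; exists g.
by rewrite Defs.actM algautE actK.
Qed.

Lemma involution_permutes d (S : set (CX K)) :
  d ^+ 2 = 1 -> (forall f, S f -> S (act d f)) -> act d @` S = S.
Proof.
move=> d2 dS; apply/seteqP; split=> [_ [f Sf <-]|f Sf]; first exact: dS.
by exists (act d f); [exact: dS | rewrite -algautE -Defs.actM -expg2 d2 act1].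
Qed.

Lemma frakD_permutes_indep : frakD_permutes (indep_gens K).
Proof.
apply: frakD_ind; first exact: permutes_subgroup.
- apply: involution_permutes out_tau2 _ => f.
  have [[e1 e2 e3 e4] [e5 e6 e7 e8] _] := tau_gens.
  by case=> [[[[[[[|]|]|]|]|]|]|] ->;
    rewrite ?(e1, e2, e3, e4, e5, e6, e7, e8) /indep_gens /=; tauto.
- apply: involution_permutes out_iota2 _ => f.
  have [[e1 e2 e3 e4] [e5 e6 e7 e8]] := iota_gens.
  by case=> [[[[[[[|]|]|]|]|]|]|] ->;
    rewrite ?(e1, e2, e3, e4, e5, e6, e7, e8) /indep_gens /=; tauto.
Qed.

Lemma act_linear d : linear (act d).
Proof. by have /asboolP[] := valP (act d). Qed.
Lemma act_monoid_morphism d : GRing.monoid_morphism (act d).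
Proof. by have /asboolP[] := valP (act d). Qed.

Lemma polyR_act d (f : CX K) : frakD d -> polyR f -> polyR (act d f).
Proof.
move=> Dd; suff h : polyR `<=` [set f : CX K | polyR (act d f)] by apply: h.
have [r1 rL rM] := gen_subalg_closed (indep_gens K).
have [d1 dM] := act_monoid_morphism d.
apply: gen_subalg_min => [|f0 /= If0]; last first.
  apply: gen_subalg_sub; rewrite -(frakD_permutes_indep Dd).
  by exists f0.
split=> [|k u v /set_mem /= Ru /set_mem /= Rv|u v /set_mem /= Ru /set_mem /= Rv].
- by apply/mem_set; change (polyR (act d 1%R)); rewrite d1; apply/set_mem.
- apply/mem_set; change (polyR (act d (k *: u + v)%R)); rewrite act_linear.
  by apply/set_mem; apply: rL; apply/mem_set.
- apply/mem_set; change (polyR (act d (u * v)%R)); rewrite dM.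
  by apply/set_mem/rM; apply/mem_set.
Qed.

(** * The group induced on the subalgebra *)

(** The automorphism [s] of the subalgebra is the restriction of the action
of [d]. *)
Definition induces (d : out Fr2) (s : algaut (RX K)) :=
  forall f : RX K, val (s f) = act d (val f).

Lemma RX_polyR (f : RX K) : polyR (val f). Proof. exact/asboolP/(valP f). Qed.

Lemma induced_exists d : frakD d -> exists s, induces d s.
Proof.
move=> Dd.
pose r c (Dc : frakD c) (f : RX K) : RX K :=
  MkRX (asboolT (polyR_act Dc (RX_polyR f))).
have bij_r : `[< bijective (r d Dd) >].
  apply/asboolP; exists (r _ (frakDV Dd)) => f; apply: val_inj; rewrite /=.
  - exact: actK.
  - exact: actVK.
have [d1 dM] := act_monoid_morphism d.
have aut_r : is_algaut (Defs.Bij bij_r).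
  apply/asboolP; split; [|split] => [k f g||f g]; apply: val_inj.
  - exact: (act_linear d).
  - exact: d1.
  - exact: dM.
by exists (AlgAut aut_r).
Qed.

Lemma induces_unique d s s' : induces d s -> induces d s' -> s = s'.
Proof. by move=> ds ds'; apply: algaut_ext => f; apply: val_inj; rewrite ds ds'. Qed.

Lemma induces1 : induces 1 1.
Proof. by move=> f; rewrite act1. Qed.

Lemma inducesM c d s s' : induces c s -> induces d s' -> induces (c * d) (s * s').
Proof. by move=> cs ds' f; rewrite Defs.actM !algautE cs ds'. Qed.

Lemma inducesX d s n : induces d s -> induces (d ^+ n) (s ^+ n).
Proof.
by move=> ds; elim: n => [|n IH]; [exact: induces1 | rewrite !expgS; apply: inducesM].
Qed.

Lemma inducesV d s : induces d s -> induces d^-1 s^-1.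
Proof.
move=> ds f; apply: (can_inj (actK d)).
by rewrite actVK -ds -algautE mulgV.
Qed.

Lemma rot_cycle :
  [/\ act out_rot (t1 K) = tm2 K, act out_rot (tm2 K) = tm1 K,
      act out_rot (tm1 K) = t2 K & act out_rot (t2 K) = t1 K].
Proof.
have [[e1 e2 e3 e4] _ _] := tau_gens; have [[f1 f2 f3 f4] _] := iota_gens.
by rewrite /out_rot !Defs.actM !algautE f1 f2 f3 f4.
Qed.

(** The values at the sample pair along the 4-cycle t1, tm2, tm1, t2. *)
Definition rot_value (n : nat) : int := nth 0%R [:: -1; 1; 0; 2]%R (n %% 4).

Lemma act_rotX n :
  act (out_rot ^+ n) (t1 K) = nth 0%R [:: t1 K; tm2 K; tm1 K; t2 K] (n %% 4).
Proof.
have [c0 c1 c2 c3] := rot_cycle.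
elim: n => [|n IH]; first exact: act1.
rewrite expgS Defs.actM algautE IH.
have -> : (n.+1 %% 4 = (n %% 4).+1 %% 4)%N by rewrite -(addn1 n) -modnDml addn1.
by case: (n %% 4) (ltn_pmod n (isT : 0 < 4)) => [|[|[|[|]]]].
Qed.

Lemma act_rot_sample n :
  act (out_rot ^+ n) (t1 K) (sample_pair K) = (rot_value n)%:~R%R.
Proof.
have [[v1 v2 v3 v4] _ _ _] := sample_values K.
rewrite act_rotX /rot_value.
by case: (n %% 4) (ltn_pmod n (isT : 0 < 4)) => [|[|[|[|]]]].
Qed.

(** A normal form is determined by the values, at the sample pair, of the images
of [t1] and [t2]. *)
Lemma dihedral_word_inj a b :
  induces out_rot a -> induces out_tau b -> injective (dihedral_word a b).
Proof.
move=> da tb; have [[e1 _ e2 _] _ _] := tau_gens.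
have R1 : polyR (t1 K) by apply: gen_subalg_sub; rewrite /indep_gens /=; tauto.
have R2 : polyR (t2 K) by apply: gen_subalg_sub; rewrite /indep_gens /=; tauto.
have word_act (i : 'I_4) (j : bool) f (Rf : polyR f) :
    val (dihedral_word a b (i, j) (MkRX (asboolT Rf))) =
    act (out_rot ^+ i) (act (out_tau ^+ j) f).
  by rewrite -algautE -Defs.actM; apply: inducesM; apply: inducesX.
(* The values of the images of [t1] and [t2]: since [t2] lies three steps after
[t1] on the 4-cycle and [out_tau] exchanges them, their exponents are [i] and
[i + 3], in an order given by [j]. *)
pose code (p : 'I_4 * bool) := if p.2 then (rot_value (p.1 + 3), rot_value p.1)
  else (rot_value p.1, rot_value (p.1 + 3)).
have t2E : t2 K = act (out_rot ^+ 3) (t1 K).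
  by rewrite act_rotX.
have word_t1 p : val (dihedral_word a b p (MkRX (asboolT R1))) (sample_pair K) =
    (code p).1%:~R%R.
  case: p => i []; rewrite word_act ?expg1 ?expg0.
    by rewrite e1 t2E -algautE -Defs.actM -expgD act_rot_sample.
  by rewrite act1 act_rot_sample.
have word_t2 p : val (dihedral_word a b p (MkRX (asboolT R2))) (sample_pair K) =
    (code p).2%:~R%R.
  case: p => i []; rewrite word_act ?expg1 ?expg0.
    by rewrite e2 act_rot_sample.
  by rewrite act1 t2E -algautE -Defs.actM -expgD act_rot_sample.
move=> p q pq; have : code p = code q.
  have [c1 c2] : (code p).1 = (code q).1 /\ (code p).2 = (code q).2.
    by split; apply: (@intr_inj K); rewrite -?word_t1 -?word_t2 pq.
  by rewrite [code p]surjective_pairing c1 c2 -surjective_pairing.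
by case: p q {pq} => [[[|[|[|[|//]]]] ?] []] [[[|[|[|[|//]]]] ?] []] // _;
  congr (_, _); apply: val_inj.
Qed.

Lemma D8_frakD_RX :
  exists phi : 'D_8%type -> algaut (RX K),
    [/\ injective phi, {morph phi : x y / x * y} & range phi = frakD_RX].
Proof.
have [a da] := induced_exists frakD_rot.
have [b tb] := induced_exists frakD_tau.
have inducesE c d s s' : c = d -> induces c s -> induces d s' -> s = s'.
  by move=> ->; apply: induces_unique.
have a4 : a ^+ 4 = 1.
  exact: (inducesE _ _ _ _ out_rot4 (inducesX 4 da) induces1).
have b2 : b ^+ 2 = 1.
  exact: (inducesE _ _ _ _ out_tau2 (inducesX 2 tb) induces1).
have ab : a ^ b = a^-1.
  apply: inducesE _ _ _ _ out_rotJ_tau _ (inducesV da).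
  by apply: inducesM; [apply: inducesV | apply: inducesM].
have [phi [phiM [range_phi phi_inj]]] := D8_morphism a4 b2 ab.
exists phi; split=> //; first by apply/phi_inj/dihedral_word_inj.
apply/seteqP; split.
  rewrite range_phi => _ [p _ <-].
  exists (out_rot ^+ p.1 * out_tau ^+ p.2).
    by apply: frakDM; apply: frakDX; [apply: frakD_rot|apply: frakD_tau].
  by apply: inducesM; apply: inducesX.
(* The elements of [out Fr2] inducing an element of the image form a subgroup, which
contains the two generators of [frakD]. *)
move=> s [d Dd ds].
suff [g dg] : [set d | exists g, induces d (phi g)] d.
  by exists g => //; apply: (induces_unique dg).
have phi_b : range phi b.
  by rewrite range_phi; exists (ord0, true); rewrite // /dihedral_word expg0 mul1g.
have phi_a : range phi a.
  by rewrite range_phi; exists (inord 1, false) => //;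
    rewrite /dihedral_word inordK // mulg1.
case: phi_a phi_b => g _ ga [h _ hb].
apply: frakD_ind Dd => /=.
- split; first by exists 1; rewrite (morphg1 phiM); apply: induces1.
  move=> c e [g' cg'] [h' eh']; exists (g' * h'^-1).
  by rewrite phiM (morphgV phiM); apply/inducesM/inducesV.
- by exists h; rewrite hb.
- by exists (h * g); rewrite phiM ga hb -out_tauM_rot; apply: inducesM.
Qed.

(** A stable set containing [t5] contains its image [tm5] under [out_tau], which
is not a generator. *)
Lemma t5_notin_stable (S : set (CX K)) :
  S `<=` all_gens K -> frakD_permutes S -> ~ S (t5 K).
Proof.
move=> Sall permS St5; apply: (@tm5_notin_gens K); apply: Sall.
rewrite -(permS _ frakD_tau); exists (t5 K) => //.
by have [_ _ ->] := tau_gens.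
Qed.

End Action.

Theorem theorem3p5p2 (R : realType) :
  (forall (d : out Fr2) (f : CX R[i]),
     frakD d -> polyR f -> polyR (out_act d f)) /\
  (exists phi : 'D_8%type -> algaut (RX R[i]),
     [/\ injective phi,
         {morph phi : x y / (x * y)%g} &
         range phi = frakD_RX]) /\
  frakD_permutes (indep_gens R[i]) /\
  ~ frakD_permutes (all_gens R[i]) /\
  (forall S : set (CX R[i]),
     S `<=` all_gens R[i] -> frakD_permutes S -> S `<=` indep_gens R[i]).
Proof.
split; [exact: polyR_act|split; [|split; [exact: frakD_permutes_indep|split]]].
- exact: D8_frakD_RX.
- by move=> permA; apply: (t5_notin_stable _ permA) => //; apply: or_intror.
- move=> S Sall permS f Sf; case: (Sall f Sf) => [//|f5].
  by case: (t5_notin_stable Sall permS); rewrite -f5.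
Qed.
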